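(* Let $s,n\ge 1$ be integers and let $\Omega$ and $\Omega_1,\ldots,\Omega_n$ be nonempty closed convex subsets of $\mathbb{R}^s$ such that at least one of them is bounded. Consider the generalized Heron problem $$\text{minimize } D(x):=\sum_{i=1}^n d(x;\Omega_i)\quad\text{subject to } x\in\Omega.$$ Let $\{\alpha_k\}_{k\ge 1}$ be a sequence of positive numbers satisfying $$\sum_{k=1}^\infty\alpha_k=\infty\quad\text{and}\quad\sum_{k=1}^\infty\alpha_k^2<\infty,$$ let $x_1\in\Omega$ be a starting point, and define the sequence $\{x_k\}$ by $$x_{k+1}=\Pi\Big(x_k-\alpha_k\sum_{i=1}^n v_{ik};\,\Omega\Big),\qquad k=1,2,\ldots,$$ where $$v_{ik}:=\frac{x_k-\omega_{ik}}{d(x_k;\Omega_i)}\ \text{ with }\ \omega_{ik}:=\Pi(x_k;\Omega_i)\quad\text{if } x_k\notin\Omega_i,$$ and $v_{ik}:=0$ otherwise. Then the sequence $\{x_k\}$ converges to an optimal solution of the generalized Heron problem, and the value sequence $$V_k:=\min\big\{D(x_j) : j=1,\ldots,k\big\}$$ converges to the optimal value $\widehat V:=\inf_{x\in\Omega}D(x)$ of this problem.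
   Context: $\|\cdot\|$ is the Euclidean norm on $\mathbb{R}^s$. For a nonempty set $A\subset\mathbb{R}^s$, $d(x;A):=\inf\{\|x-y\| : y\in A\}$; for $A$ nonempty, closed and convex, $\Pi(x;A)$ denotes the unique point $y\in A$ with $\|x-y\|=d(x;A)$ (the Euclidean projection). An optimal solution of the problem is a point $\bar x\in\Omega$ with $D(\bar x)\le D(x)$ for all $x\in\Omega$. *)

(* Defs.v *)
From HB Require Import structures.
From mathcomp Require Import all_boot all_order all_algebra.
From mathcomp Require Import all_classical all_reals all_analysis.
Set Implicit Arguments.
Unset Strict Implicit.
Unset Printing Implicit Defensive.
Import Order.TTheory GRing.Theory Num.Theory.
Import numFieldNormedType.Exports.

Local Open Scope classical_set_scope.
Local Open Scope ring_scope.

(* The library norm on 'rV[R]_s is the max norm. It induces the usual topology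
   and the usual bounded sets, so [closed], [bounded_set] and convergence are
   those of the library; distances and projections use the Euclidean norm. *)
Definition enorm (R : realType) (s : nat) (x : 'rV[R]_s) : R :=
  Num.sqrt (\sum_(i < s) x ord0 i ^+ 2).

(* A real infimum: meaningful only for nonempty A. *)
Definition edist (R : realType) (s : nat) (x : 'rV[R]_s) (A : set 'rV[R]_s)
    : R :=
  inf [set enorm (x - y) | y in A].

(* [get] selects a point with this property; it exists and is unique when A is
   nonempty, closed and convex, and the value is a default point otherwise. *)
Definition eproj (R : realType) (s : nat) (x : 'rV[R]_s) (A : set 'rV[R]_s)
    : 'rV[R]_s :=
  get [set y | A y /\ enorm (x - y) = edist x A].

Definition heron_cost (R : realType) (s n : nat)
    (Omegas : 'I_n -> set 'rV[R]_s) (x : 'rV[R]_s) : R :=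
  \sum_(i < n) edist x (Omegas i).

Definition heron_solution (R : realType) (s n : nat) (Omega : set 'rV[R]_s)
    (Omegas : 'I_n -> set 'rV[R]_s) (xbar : 'rV[R]_s) : Prop :=
  Omega xbar /\
  forall x, Omega x -> heron_cost Omegas xbar <= heron_cost Omegas x.

Definition heron_value (R : realType) (s n : nat) (Omega : set 'rV[R]_s)
    (Omegas : 'I_n -> set 'rV[R]_s) : R :=
  inf [set heron_cost Omegas x | x in Omega].

(* Off A, the gradient at x of the distance to A. *)
Definition heron_dir (R : realType) (s : nat) (x : 'rV[R]_s)
    (A : set 'rV[R]_s) : 'rV[R]_s :=
  if x \in A then 0 else (edist x A)^-1 *: (x - eproj x A).

(* Meaningful for k >= 1; the minimum over j = 1, ..., k. *)
Definition heron_best (R : realType) (s n : nat)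
    (Omegas : 'I_n -> set 'rV[R]_s) (x_ : nat -> 'rV[R]_s) (k : nat) : R :=
  \big[Num.min/heron_cost Omegas (x_ 1%N)]_(1 <= j < k.+1)
    heron_cost Omegas (x_ j).

(* Main.v *)
(* Euclidean projection onto a closed convex set A does not increase the distance
   to any point of A, and off Omega_i the vector v_ik is a subgradient of norm 1
   of the distance to Omega_i. Hence, for every y in Omega,
     |x_{k+1} - y|^2 + 2 alpha_k (D(x_k) - D(y))
       <= |x_k - y|^2 + n^2 alpha_k^2.
   Taking y optimal and summing, divergence of the sum of alpha_k makes
   D(x_k) come arbitrarily close to the optimal value infinitely often, while
   x_k stays bounded. A cluster point z of a minimizing subsequence is optimal,
   so the inequality holds for y = z; as the tails of the sum of alpha_k^2 tend
   to 0, once x_m is close to z all later iterates stay close to z. *)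
From Pilot Require Import Defs.
From HB Require Import structures.
From mathcomp Require Import all_boot all_order all_algebra.
From mathcomp Require Import all_classical all_reals all_analysis.
From mathcomp Require Import ring lra.
Set Implicit Arguments.
Unset Strict Implicit.
Unset Printing Implicit Defensive.
Import Order.TTheory GRing.Theory Num.Theory.
Import numFieldNormedType.Exports.
(* The analysis library has its own [edist]; this makes the name denote ours. *)
Import Pilot.Defs.
Local Open Scope classical_set_scope.
Local Open Scope ring_scope.

(** * Euclidean inner product and norm on row vectors *)

Section EuclideanSpace.
Variables (R : realType) (s : nat).
Implicit Types (x y u v : 'rV[R]_s) (a c : R) (A : set 'rV[R]_s).

Definition dotr u v : R := \sum_(i < s) u ord0 i * v ord0 i.

Lemma dotrC u v : dotr u v = dotr v u.
Proof. by apply: eq_bigr => i _; rewrite mulrC. Qed.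

Lemma dotrDl u v x : dotr (u + v) x = dotr u x + dotr v x.
Proof. by rewrite -big_split; apply: eq_bigr => i _; rewrite mxE mulrDl. Qed.

Lemma dotrZl a u v : dotr (a *: u) v = a * dotr u v.
Proof. by rewrite mulr_sumr; apply: eq_bigr => i _; rewrite mxE mulrA. Qed.

Lemma dotrNl u v : dotr (- u) v = - dotr u v.
Proof. by rewrite -scaleN1r dotrZl mulN1r. Qed.

Lemma dotrBl u v x : dotr (u - v) x = dotr u x - dotr v x.
Proof. by rewrite dotrDl dotrNl. Qed.

Lemma dotrDr x u v : dotr x (u + v) = dotr x u + dotr x v.
Proof. by rewrite dotrC dotrDl !(dotrC x). Qed.

Lemma dotrZr a x u : dotr x (a *: u) = a * dotr x u.
Proof. by rewrite dotrC dotrZl (dotrC x). Qed.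

Lemma dotrBr x u v : dotr x (u - v) = dotr x u - dotr x v.
Proof. by rewrite dotrC dotrBl !(dotrC x). Qed.

Lemma dotrB2 u v : dotr (u - v) (u - v) = dotr u u - 2 * dotr u v + dotr v v.
Proof. by rewrite dotrBl !dotrBr (dotrC v u); ring. Qed.

Lemma dotr_suml (I : finType) (F : I -> 'rV[R]_s) x :
  dotr (\sum_i F i) x = \sum_i dotr (F i) x.
Proof.
apply: (big_morph (dotr^~ x)) => [u v|]; first exact: dotrDl.
by rewrite -(scale0r x) dotrZl mul0r.
Qed.

Lemma dotrr_ge0 u : 0 <= dotr u u.
Proof. by apply: sumr_ge0 => i _; rewrite -expr2 sqr_ge0. Qed.

Lemma enorm_ge0 u : 0 <= enorm u.
Proof. exact: sqrtr_ge0. Qed.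

Lemma sqr_enorm u : enorm u ^+ 2 = dotr u u.
Proof.
rewrite sqr_sqrtr; last by apply: sumr_ge0 => i _; exact: sqr_ge0.
by apply: eq_bigr => i _; rewrite expr2.
Qed.

Lemma ler_abs_enorm u i : `|u ord0 i| <= enorm u.
Proof.
rewrite -sqrtr_sqr ler_wsqrtr// (bigD1 i)//= lerDl.
by apply: sumr_ge0 => j _; exact: sqr_ge0.
Qed.

Lemma enorm_eq0 u : enorm u = 0 -> u = 0.
Proof.
move=> u0; apply/rowP => i; rewrite mxE; apply/eqP.
by rewrite -normr_eq0 eq_le normr_ge0 andbT -u0 ler_abs_enorm.
Qed.

Lemma enormN u : enorm (- u) = enorm u.
Proof. by congr Num.sqrt; apply: eq_bigr => i _; rewrite mxE sqrrN. Qed.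

Lemma enormBC u v : enorm (u - v) = enorm (v - u).
Proof. by rewrite -enormN opprB. Qed.

Lemma enorm0 : enorm (0 : 'rV[R]_s) = 0.
Proof.
by rewrite /enorm big1 ?sqrtr0// => i _; rewrite mxE expr0n.
Qed.

Lemma enormZ a u : enorm (a *: u) = `|a| * enorm u.
Proof.
apply/eqP; rewrite -(@eqrXn2 _ 2)// ?mulr_ge0 ?enorm_ge0// exprMn.
by rewrite !sqr_enorm dotrZl dotrZr real_normK ?num_real// mulrA -expr2.
Qed.

(** Cauchy-Schwarz, from the nonnegative square of [dotr v v *: u - dotr u v *: v], a multiple of
    the part of [u] orthogonal to [v]. *)
Lemma dotr_le_enorm u v : dotr u v <= enorm u * enorm v.
Proof.
have [v0|v_neq0] := eqVneq (enorm v) 0.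
  by rewrite (enorm_eq0 v0) enorm0 mulr0 -(scale0r v) dotrZr mul0r.
have := dotrr_ge0 (dotr v v *: u - dotr u v *: v).
rewrite dotrBl !dotrBr !dotrZl !dotrZr (dotrC v u) => h.
have v_gt0 : 0 < dotr v v by rewrite -sqr_enorm exprn_gt0// lt0r v_neq0 enorm_ge0.
apply: le_trans (ler_norm _) _.
rewrite -(@ler_pXn2r _ 2)// ?nnegrE ?mulr_ge0 ?enorm_ge0//.
rewrite real_normK ?num_real// exprMn !sqr_enorm -(ler_pM2l v_gt0).
by nra.
Qed.

Lemma ler_enormD u v : enorm (u + v) <= enorm u + enorm v.
Proof.
rewrite -(@ler_pXn2r _ 2)// ?nnegrE ?addr_ge0 ?enorm_ge0//.
rewrite sqrrD !sqr_enorm dotrDl !dotrDr (dotrC v u).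
by have := dotr_le_enorm u v; lra.
Qed.

Lemma ler_enorm_sum (I : finType) (F : I -> 'rV[R]_s) :
  enorm (\sum_i F i) <= \sum_i enorm (F i).
Proof.
elim/big_ind2 : _ => [|u a v c ua vc|//]; first by rewrite enorm0.
by apply: le_trans (ler_enormD _ _) _; exact: lerD.
Qed.

(** * Comparison with the max norm, continuity, existence of minima *)

Lemma ler_norm_enorm u : `|u| <= enorm u.
Proof.
rewrite {1}/Num.norm/= mx_normrE; apply/bigmax_leP; split; first exact: enorm_ge0.
by move=> [i j] _ /=; rewrite (ord1 i) ler_abs_enorm.
Qed.

Lemma ler_enorm_norm u : enorm u <= s%:R * `|u|.
Proof.
have u_le i : `|u ord0 i| <= `|u|.
  rewrite [leRHS]/Num.norm/= mx_normrE; apply/bigmax_geP; right.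
  by exists (ord0, i).
rewrite -(@ler_pXn2r _ 2)// ?nnegrE ?mulr_ge0 ?enorm_ge0//.
rewrite sqr_enorm exprMn; apply: (@le_trans _ _ (s%:R * `|u| ^+ 2)).
  rewrite -[X in X%:R]card_ord mulr_natl -sumr_const; apply: ler_sum => i _.
  by rewrite -expr2 -real_normK ?num_real// ler_pXn2r ?nnegrE.
rewrite ler_wpM2r ?exprn_ge0// -natrX ler_nat.
by case: (s) => // k; rewrite expnS leq_pmulr// expn_gt0.
Qed.

(** The one-sided bound suffices, since exchanging [x] and [y] bounds the opposite difference. *)
Lemma continuous_lipschitz_enorm (f : 'rV[R]_s -> R) (c : R) : 0 <= c ->
  (forall x y, f x - f y <= c * enorm (x - y)) -> continuous f.
Proof.
move=> c0 fc x; apply/(@cvgrPdist_le _ _ _ _ (nbhs_filter x)) => e e0.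
(* The [+ 1] keeps the denominator positive when [c] or [s] is zero. *)
have d0 : 0 < e / (c * s%:R + 1) by rewrite divr_gt0// ltr_wpDl// mulr_ge0.
near=> y.
have xy : `|x - y| <= e / (c * s%:R + 1).
  by near: y; move/cvgrPdist_le : (@cvg_id _ (nbhs x)); exact.
apply: (@le_trans _ _ (c * enorm (x - y))).
  by rewrite ler_norml lerNl opprB {1}enormBC !fc.
apply: (@le_trans _ _ (c * s%:R * `|x - y|)).
  by rewrite -mulrA ler_wpM2l// ler_enorm_norm.
apply: (@le_trans _ _ ((c * s%:R + 1) * `|x - y|)).
  by rewrite ler_wpM2r// lerDl.
by rewrite mulrC -ler_pdivlMr// ltr_wpDl// mulr_ge0.
Unshelve. all: by end_near. Qed.

Lemma continuous_enormB x : continuous (fun y => enorm (x - y)).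
Proof.
apply: (@continuous_lipschitz_enorm _ 1) => // u v; rewrite mul1r lerBlDr.
have -> : x - u = (v - u) + (x - v) by rewrite [RHS]addrC subrKA.
by rewrite (enormBC u v) ler_enormD.
Qed.

Lemma bounded_setP A :
  bounded_set A <-> exists M : R, forall y, A y -> `|y| <= M.
Proof.
split=> [|[M AM]]; last first.
  exists M; split; first exact: num_real.
  by move=> N /ltW MN y Ay; exact: le_trans (AM y Ay) MN.
by move=> /ex_strict_bound_gt0[M _ AM]; exists M => y Ay; exact/ltW/AM.
Qed.

(** The part of [A] where [f] is at most [f x] is compact and contains [x]; its minimizer is global
    on [A] because elsewhere [f] exceeds [f x]. *)
Lemma exists_min_bounded_sublevel A (f : 'rV[R]_s -> R) x (M : R) :
  closed A -> continuous f -> A x ->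
  (forall y, A y -> f y <= f x -> enorm y <= M) ->
  exists2 y, A y & forall z, A z -> f y <= f z.
Proof.
move=> cA cf Ax fM.
pose B := A `&` f @^-1` [set a | a <= f x].
have cB : compact B.
  apply: bounded_closed_compact.
    apply/bounded_setP; exists M => y [Ay fy].
    by apply: le_trans (ler_norm_enorm _) _; exact: fM.
  apply: closedI => //; apply: preimage_closed; last exact: closed_le.
  by move=> y _; exact: cf.
have Bx : B x by split=> /=.
have [|y /set_mem[Ay fy] ymin] :=
  compact_EVT_min _ cB (continuous_subspaceT cf); first by exists x.
exists y => // z Az; have [fz|/ltW fz] := leP (f z) (f x).
  by apply: ymin; rewrite inE.
exact: le_trans fz.
Qed.

(** * Distance to a set and projection onto it *)

Lemma edist_le x y A : A y -> edist x A <= enorm (x - y).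
Proof.
move=> Ay; apply: ge_inf; last by exists y.
by exists 0 => _ [z _ <-]; exact: enorm_ge0.
Qed.

Lemma edist_ge x A c : A !=set0 ->
  (forall y, A y -> c <= enorm (x - y)) -> c <= edist x A.
Proof.
move=> [y Ay] h; apply: lb_le_inf; first by exists (enorm (x - y)); exists y.
by move=> _ [z Az <-]; exact: h.
Qed.

Lemma edist_ge0 x A : A !=set0 -> 0 <= edist x A.
Proof. by move=> A0; apply: edist_ge => // y _; exact: enorm_ge0. Qed.

Lemma edistB x y A : A !=set0 -> edist x A - edist y A <= enorm (x - y).
Proof.
move=> A0; rewrite lerBlDr -lerBlDl; apply: edist_ge => // z Az.
rewrite lerBlDl; apply: le_trans (edist_le x Az) _.
by rewrite -[x - z](subrKA y) ler_enormD.
Qed.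

Lemma eprojP x A : A !=set0 -> closed A ->
  A (eproj x A) /\ enorm (x - eproj x A) = edist x A.
Proof.
move=> [y0 Ay0] cA; apply: (@getPex _ [set y | A y /\ enorm (x - y) = edist x A]).
have [|y Ay ymin] := @exists_min_bounded_sublevel A (fun y => enorm (x - y)) y0
    (enorm (x - y0) + enorm x) cA (@continuous_enormB x) Ay0.
  move=> y Ay h; rewrite -[y](subrK x); apply: le_trans (ler_enormD _ _) _.
  by rewrite lerD2r (enormBC y).
exists y; split=> //; apply/eqP; rewrite eq_le edist_le// andbT.
by apply: edist_ge => //; exists y0.
Qed.

Lemma convex_setP A x y (t : R) : convex_set A -> A x -> A y ->
  0 <= t -> t <= 1 -> A (x + t *: (y - x)).
Proof.
move=> cA Ax Ay t0 t1.
have /set_mem := cA y x (Itv01 t0 t1) (mem_set Ay) (mem_set Ax).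
rewrite /conv/= /unstable.onem; congr (A _).
by rewrite scalerBl scale1r scalerBr addrCA.
Qed.

(** Were the inner product positive, a short move from the projection towards [y], which stays in
    [A], would come closer to [x]. *)
Lemma eproj_obtuse x y A : closed A -> convex_set A -> A y ->
  dotr (x - eproj x A) (y - eproj x A) <= 0.
Proof.
move=> cA vA Ay; have [|Ap dp] := eprojP x _ cA; first by exists y.
move: Ap dp; set p := eproj x A => Ap dp.
rewrite leNgt; apply/negP => c0.
set c := dotr _ _ in c0; pose N := dotr (y - p) (y - p).
have N0 : 0 <= N by exact: dotrr_ge0.
have cN : 0 < c + N by rewrite ltr_wpDr.
(* Moving by [t] changes the squared distance by [t * (t * N - 2 * c)]; this [t] is at most 1 and
   gives [t * N <= c < 2 * c]. *)
pose t := c / (c + N).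
have t0 : 0 < t by rewrite divr_gt0.
have t1 : t <= 1 by rewrite ler_pdivrMr// mul1r lerDl.
have := edist_le x (convex_setP vA Ap Ay (ltW t0) t1).
rewrite -dp -(@ler_pXn2r _ 2)// ?nnegrE ?enorm_ge0// !sqr_enorm opprD addrA.
rewrite (dotrBl (x - p)) !(dotrBr _ (x - p)) !dotrZl !dotrZr.
rewrite (dotrC (y - p) (x - p)) -/c -/N => h.
have tcN : t * (c + N) = c by rewrite divfK// gt_eqF.
have {h} : t * (2 * c) <= t * (t * N) by lra.
by rewrite ler_pM2l// => h; nra.
Qed.

(** In the expanded square of [(x - p) - (y - p)], the obtuse angle at the projection [p] makes the
    cross term nonnegative. *)
Lemma eproj_nonexpansive x y A : closed A -> convex_set A -> A y ->
  dotr (eproj x A - y) (eproj x A - y) <= dotr (x - y) (x - y).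
Proof.
move=> cA vA Ay; have := eproj_obtuse x cA vA Ay; set p := eproj x A.
have -> : x - y = (x - p) - (y - p) by rewrite opprB addrA subrK.
rewrite (dotrB2 (x - p)) -(opprB y p) dotrNl (dotrC (y - p)) dotrNl opprK => uv.
by have := dotrr_ge0 (x - p); lra.
Qed.

(** * The direction [heron_dir] as a subgradient of the distance *)

Lemma enorm_heron_dir x A : A !=set0 -> closed A -> enorm (heron_dir x A) <= 1.
Proof.
move=> A0 cA; rewrite /heron_dir; case: ifP => _; first by rewrite enorm0.
have [_ dp] := eprojP x A0 cA; rewrite enormZ dp.
have [->|d0] := eqVneq (edist x A) 0; first by rewrite mulr0.
by rewrite normfV ger0_norm ?edist_ge0// mulVf.
Qed.

(* Obtuseness at [p = eproj x A] gives [<x - p, q - p> <= 0] for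
   [q = eproj y A], so only [<x - p, y - q>] has to be estimated. *)
Lemma heron_dir_subgradient x y A : A !=set0 -> closed A -> convex_set A ->
  edist x A + dotr (heron_dir x A) (y - x) <= edist y A.
Proof.
move=> A0 cA vA; rewrite /heron_dir; case: ifPn => [/set_mem Ax|/negP xA].
  rewrite -(scale0r y) dotrZl mul0r addr0.
  by apply: le_trans (edist_le x Ax) _; rewrite subrr enorm0 edist_ge0.
have [Ap dp] := eprojP x A0 cA; have [Aq dq] := eprojP y A0 cA.
have := eproj_obtuse x cA vA Aq.
move: Ap dp Aq dq; set p := eproj x A; set q := eproj y A => Ap dp Aq dq obt.
have d0 : 0 < edist x A.
  rewrite lt0r edist_ge0// andbT -dp; apply/eqP => /enorm_eq0/subr0_eq xp.
  by apply: xA; rewrite inE xp.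
rewrite -(ler_pM2l d0) dotrZl mulrDr mulVKf ?gt_eqF//.
have -> : y - x = (y - q) + ((q - p) - (x - p)).
  by rewrite opprB !subrKA.
rewrite dotrDr (dotrBr _ (q - p)) -sqr_enorm.
have := dotr_le_enorm (x - p) (y - q).
by rewrite dp dq; lra.
Qed.

End EuclideanSpace.

(** * Tails of series and a summed descent recursion *)

Section RealSeries.
Variable R : realType.
Implicit Types (a b c u : nat -> R) (e B : R).

(** The partial sums [T] are bounded by the value of the series; past an index where [T] is within
    [e] of its supremum, no increment of [T] can reach [e]. *)
Lemma summable_tail_lt u e : (forall k, (1 <= k)%N -> 0 <= u k) ->
  (\sum_(1 <= k <oo) (u k)%:E < +oo)%E -> 0 < e ->
  exists2 N, (1 <= N)%N &
    forall m n, (N <= m)%N -> \sum_(m <= k < n) u k < e.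
Proof.
move=> u0 uoo e0; pose T n := \sum_(1 <= k < n) u k.
have leT m n : (1 <= m)%N -> (m <= n)%N -> T n = T m + \sum_(m <= k < n) u k.
  by move=> m1 mn; rewrite /T (big_cat_nat m1 mn).
have sum_ge0 m n : (1 <= m)%N -> 0 <= \sum_(m <= k < n) u k.
  move=> m1; rewrite big_nat_cond; apply: sumr_ge0 => k /andP[/andP[mk _] _].
  exact/u0/(leq_trans m1 mk).
have supT : has_sup (range T).
  split; first by exists (T 0); exists 0%N.
  exists (fine (\sum_(1 <= k <oo) (u k)%:E)%E) => _ [n _ <-].
  have uE k : (1 <= k)%N -> true -> (0 <= (u k)%:E)%E.
    by move=> k1 _; rewrite lee_fin u0.
  rewrite -lee_fin fineK; last first.
    by rewrite ge0_fin_numE// nneseries_ge0.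
  by rewrite /T -sumEFin; exact: nneseries_lim_ge.
have [_ [N0 _ <-] TN0] := sup_adherent e0 supT.
(* Terms are known to be nonnegative only from index 1 on. *)
exists (maxn N0 1); rewrite ?leq_maxr// => m n; rewrite geq_max => /andP[N0m m1].
have [nm|/ltnW mn] := leqP n m; first by rewrite big_geq.
have TN0m : T N0 <= T m.
  case: N0 N0m {TN0} => [|N0] N0m; first by rewrite {1}/T big_geq// sum_ge0.
  by rewrite (leT _ _ _ N0m)// lerDl sum_ge0.
have := sup_upper_bound supT (ex_intro2 _ _ n I erefl : range T (T n)).
by rewrite (leT _ _ m1 mn); lra.
Qed.

(** Otherwise the partial sums past [N] are at most the sum before [N] plus [B], so the series
    cannot be infinite. *)
Lemma divergent_tail_gt u N B : (forall k, (1 <= k)%N -> 0 <= u k) ->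
  (\sum_(1 <= k <oo) (u k)%:E = +oo)%E -> (1 <= N)%N ->
  exists2 n, (N <= n)%N & B < \sum_(N <= k < n) u k.
Proof.
move=> u0 uoo N1; apply: contrapT => /forall2NP h.
have le n : (N <= n)%N -> \sum_(N <= k < n) u k <= B.
  by move=> Nn; have [//|/negP] := h n; rewrite -leNgt.
have uE k : (1 <= k)%N -> true -> (0 <= (u k)%:E)%E.
  by move=> k1 _; rewrite lee_fin u0.
suff : (+oo <= (\sum_(1 <= k < N) u k + B)%:E)%E by rewrite leye_eq.
rewrite -uoo; apply: lime_le; first exact: is_cvg_nneseries.
near=> n; have Nn : (N <= n)%N by near: n; exact: nbhs_infty_ge.
by rewrite sumEFin lee_fin (big_cat_nat N1 Nn)/= lerD2l le.
Unshelve. all: by end_near. Qed.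

Lemma telescope_le a b c m n :
  (forall k, (m <= k)%N -> a k.+1 + b k <= a k + c k) -> (m <= n)%N ->
  a n + \sum_(m <= k < n) b k <= a m + \sum_(m <= k < n) c k.
Proof.
move=> h /subnKC <-; elim: (n - m)%N => [|j IH].
  by rewrite addn0 !big_geq.
rewrite addnS !big_nat_recr ?leq_addr//=.
by have := h _ (leq_addr j m); lra.
Qed.

(** Were [g] at least [e] from index [m] on, summing the recursion would bound [2 * e] times the sum
    of [alpha] by [a m + C], against divergence. *)
Lemma exists_small_gap (a g alpha : nat -> R) (C e : R) N :
  (forall k, 0 <= a k) -> 0 <= C ->
  (forall k, (1 <= k)%N -> 0 < alpha k) ->
  (\sum_(1 <= k <oo) (alpha k)%:E = +oo)%E ->
  (\sum_(1 <= k <oo) (alpha k ^+ 2)%:E < +oo)%E ->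
  (forall k, (1 <= k)%N ->
     a k.+1 + 2 * alpha k * g k <= a k + C * alpha k ^+ 2) ->
  0 < e -> exists2 k, (N <= k)%N & g k < e.
Proof.
move=> a0 C0 al0 aloo al2 rec e0; apply: contrapT => /forall2NP h.
have [|N1 N1_ge1 tail] := summable_tail_lt _ al2 ltr01.
  by move=> k _; exact: sqr_ge0.
pose m := maxn N N1.
have m1 : (1 <= m)%N by rewrite (leq_trans N1_ge1)// leq_maxr.
have ge k : (m <= k)%N -> e <= g k.
  move=> mk; have [/negP|/negP] := h k; last by rewrite -leNgt.
  by rewrite (leq_trans _ mk)// leq_maxl.
(* The threshold is that bound over [2 * e]: [a n] is nonnegative and the squares beyond [m] sum to
   less than 1. *)
have [|n mn] := divergent_tail_gt ((a m + C) / (2 * e)) _ aloo m1.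
  by move=> k k1; exact/ltW/al0.
apply/negP; rewrite -leNgt ler_pdivlMr ?mulr_gt0//.
have rec' k : (m <= k)%N ->
    a k.+1 + 2 * e * alpha k <= a k + C * alpha k ^+ 2.
  move=> mk; have k1 := leq_trans m1 mk; apply: le_trans (rec k k1).
  by rewrite lerD2l mulrAC ler_wpM2l ?ge// mulr_ge0// ltW// al0.
have := telescope_le rec' mn; rewrite -!mulr_sumr mulrC => tel.
have /ltW := tail m n (leq_maxr _ _); move=> /(ler_wpM2l C0).
by have := a0 n; lra.
Qed.

End RealSeries.

(** * The cost function: minimizers and the one-step inequality *)

Section HeronCost.
Variables (R : realType) (s n : nat) (Omegas : 'I_n -> set 'rV[R]_s).
Hypothesis Omegas_neq0 : forall i, Omegas i !=set0.
Implicit Types x y : 'rV[R]_s.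

Lemma heron_costB x y :
  heron_cost Omegas x - heron_cost Omegas y <= n%:R * enorm (x - y).
Proof.
rewrite /heron_cost -sumrB -[X in X%:R]card_ord mulr_natl -sumr_const.
by apply: ler_sum => i _; exact: edistB.
Qed.

Lemma continuous_heron_cost : continuous (heron_cost Omegas).
Proof.
by apply: (@continuous_lipschitz_enorm _ _ _ n%:R) => //; exact: heron_costB.
Qed.

Lemma le_edist_heron_cost i x : edist x (Omegas i) <= heron_cost Omegas x.
Proof.
rewrite /heron_cost (bigD1 i)//= lerDl.
by apply: sumr_ge0 => j _; exact: edist_ge0.
Qed.

(** Sublevel sets of the cost in [Omega] are bounded: either [Omega] itself is, or the cost
    dominates the distance to a bounded [Omegas i]. *)
Lemma exists_heron_solution (Omega : set 'rV[R]_s) :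
  Omega !=set0 -> closed Omega ->
  (bounded_set Omega \/ exists i, bounded_set (Omegas i)) ->
  exists xbar, heron_solution Omega Omegas xbar.
Proof.
move=> [x0 Ox0] cO bdd.
suff [M OM] : exists M, forall y, Omega y ->
    heron_cost Omegas y <= heron_cost Omegas x0 -> enorm y <= M.
  have [y Oy ymin] :=
    exists_min_bounded_sublevel cO continuous_heron_cost Ox0 OM.
  by exists y.
have enorm_le (A : set 'rV[R]_s) : bounded_set A ->
    exists M, forall y, A y -> enorm y <= M.
  move=> /bounded_setP[M AM]; exists (s%:R * M) => y Ay.
  by apply: le_trans (ler_enorm_norm y) _; rewrite ler_wpM2l// AM.
case: bdd => [/enorm_le[M OM]|[i /enorm_le[M OM]]].
  by exists M => y Oy _; exact: OM.
(* With norms on [Omegas i] at most [M], its distance from [y] is at least [enorm y - M]. *)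
exists (heron_cost Omegas x0 + M) => y _ yx0; rewrite -lerBlDr.
apply: le_trans yx0; apply: le_trans (le_edist_heron_cost i y).
apply: edist_ge => // z Oz; rewrite lerBlDr -{1}(subrK z y).
by apply: le_trans (ler_enormD _ _) _; rewrite lerD2l OM.
Qed.

Lemma heron_valueE (Omega : set 'rV[R]_s) xbar :
  heron_solution Omega Omegas xbar ->
  heron_value Omega Omegas = heron_cost Omegas xbar.
Proof.
move=> [Ox xmin]; apply/eqP; rewrite eq_le; apply/andP; split.
  apply: ge_inf; last by exists xbar.
  by exists (heron_cost Omegas xbar) => _ [y Oy <-]; exact: xmin.
apply: lb_le_inf; first by exists (heron_cost Omegas xbar); exists xbar.
by move=> _ [y Oy <-]; exact: xmin.
Qed.

Hypothesis Omegas_closed : forall i, closed (Omegas i).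
Hypothesis Omegas_convex : forall i, convex_set (Omegas i).

Lemma heron_cost_subgradient x y :
  heron_cost Omegas x + dotr (\sum_(i < n) heron_dir x (Omegas i)) (y - x) <=
  heron_cost Omegas y.
Proof.
rewrite dotr_suml -big_split; apply: ler_sum => i _.
exact: heron_dir_subgradient.
Qed.

Lemma enorm_sum_heron_dir x :
  enorm (\sum_(i < n) heron_dir x (Omegas i)) <= n%:R.
Proof.
apply: le_trans (ler_enorm_sum _) _.
rewrite -[leRHS]mulr1 -[X in X%:R]card_ord mulr_natl -sumr_const.
by apply: ler_sum => i _; exact: enorm_heron_dir.
Qed.

(** Nonexpansiveness reduces this to the unprojected point [x - a *: v]; in its expanded square the
    cross term is controlled by the subgradient inequality and [enorm v] by [n]. *)
Lemma heron_step (Omega : set 'rV[R]_s) x y (a : R) :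
  closed Omega -> convex_set Omega -> Omega y -> 0 <= a ->
  let x' := eproj (x - a *: \sum_(i < n) heron_dir x (Omegas i)) Omega in
  enorm (x' - y) ^+ 2 + 2 * a * (heron_cost Omegas x - heron_cost Omegas y) <=
  enorm (x - y) ^+ 2 + n%:R ^+ 2 * a ^+ 2.
Proof.
move=> cO vO Oy a0 /=; set v := \sum_(i < n) _.
have := eproj_nonexpansive (x - a *: v) cO vO Oy.
set x' := eproj _ _; rewrite -(sqr_enorm (x' - y)).
have -> : x - a *: v - y = (x - y) - a *: v by rewrite addrAC.
rewrite dotrB2 dotrZl !dotrZr (dotrC (x - y) v) -!sqr_enorm => h.
have : heron_cost Omegas x - heron_cost Omegas y <= dotr v (x - y).
  have := heron_cost_subgradient x y; rewrite -/v.
  by rewrite -(opprB x y) (dotrC v) dotrNl (dotrC _ v); lra.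
move=> /(ler_wpM2l a0) sub.
have : enorm v ^+ 2 <= n%:R ^+ 2.
  by rewrite ler_pXn2r ?nnegrE ?enorm_ge0// enorm_sum_heron_dir.
move=> /(ler_wpM2l (sqr_ge0 a)).
by lra.
Qed.

End HeronCost.

(** * Cluster points of the iterates and convergence *)

Lemma compact_cluster_enorm (R : realType) (s : nat) (K : set 'rV[R]_s)
    (w : nat -> 'rV[R]_s) : compact K -> (forall j, K (w j)) ->
  exists2 z, K z & forall (e : R) N, 0 < e ->
    exists2 j, (N <= j)%N & enorm (z - w j) < e.
Proof.
move=> cK Kw; have [|z [Kz clz]] := cK (w @ \oo) _.
  by exists 0%N => // j _; exact: Kw.
exists z => // e N e0.
have /clz : (w @ \oo) (w @` [set j | (N <= j)%N]) by exists N => // j Nj; exists j.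
(* Euclidean balls are neighbourhoods in the max norm topology, by continuity of the distance to
   [z]. *)
have nz : nbhs z [set y | enorm (z - y) < e].
  have /cvgrPdist_lt /(_ e e0) := @continuous_enormB R s z z.
  rewrite subrr enorm0; apply: filterS => y /=.
  by rewrite sub0r normrN ger0_norm ?enorm_ge0.
by move=> /(_ _ nz)[_ [[j Nj <-]]]; exists j.
Qed.

Lemma le_heron_best (R : realType) (s n : nat) (Omegas : 'I_n -> set 'rV[R]_s)
    (x_ : nat -> 'rV[R]_s) (c : R) k :
  (forall j, (1 <= j)%N -> c <= heron_cost Omegas (x_ j)) ->
  c <= heron_best Omegas x_ k.
Proof.
move=> h; rewrite /heron_best big_nat_cond; apply: le_bigmin; first exact: h.
by move=> j /andP[/andP[j1 _] _]; exact: h.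
Qed.

Lemma heron_best_le (R : realType) (s n : nat) (Omegas : 'I_n -> set 'rV[R]_s)
    (x_ : nat -> 'rV[R]_s) j k : (1 <= j <= k)%N ->
  heron_best Omegas x_ k <= heron_cost Omegas (x_ j).
Proof. by move=> jk; apply: ge_bigmin_seq; rewrite ?mem_index_iota. Qed.

Theorem theorem4p1 (R : realType) (s n : nat) (hs : (1 <= s)%N) (hn : (1 <= n)%N)
    (Omega : set 'rV[R]_s) (Omegas : 'I_n -> set 'rV[R]_s)
    (Omega_neq0 : Omega !=set0) (Omega_closed : closed Omega)
    (Omega_convex : convex_set Omega)
    (Omegas_neq0 : forall i, Omegas i !=set0)
    (Omegas_closed : forall i, closed (Omegas i))
    (Omegas_convex : forall i, convex_set (Omegas i))
    (some_bounded : bounded_set Omega \/ exists i, bounded_set (Omegas i))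
    (alpha : nat -> R)
    (alpha_gt0 : forall k, (1 <= k)%N -> 0 < alpha k)
    (alpha_sum : (\sum_(1 <= k <oo) (alpha k)%:E = +oo)%E)
    (alpha_sum2 : (\sum_(1 <= k <oo) (alpha k ^+ 2)%:E < +oo)%E)
    (x_ : nat -> 'rV[R]_s) (x1_Omega : Omega (x_ 1%N))
    (x_rec : forall k, (1 <= k)%N ->
       x_ k.+1 =
       eproj (x_ k - alpha k *: \sum_(i < n) heron_dir (x_ k) (Omegas i))
             Omega) :
  (exists xbar : 'rV[R]_s, heron_solution Omega Omegas xbar /\
     x_ k @[k --> \oo] --> xbar) /\
  heron_best Omegas x_ k @[k --> \oo] --> heron_value Omega Omegas.
Proof.
have [xbar sol] := exists_heron_solution Omegas_neq0 Omega_neq0 Omega_closed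
  some_bounded.
have [Oxbar xbar_min] := sol.
pose D := heron_cost Omegas.
pose V := D xbar.
have valE : heron_value Omega Omegas = V := heron_valueE sol.
have xO k : (1 <= k)%N -> Omega (x_ k).
  case: k => // k _; elim: k => [//|k IH]; rewrite x_rec//.
  by have [] := eprojP (x_ k.+1 -
    alpha k.+1 *: \sum_(i < n) heron_dir (x_ k.+1) (Omegas i))
    Omega_neq0 Omega_closed.
have step y k : Omega y -> (1 <= k)%N ->
    enorm (x_ k.+1 - y) ^+ 2 + 2 * alpha k * (D (x_ k) - D y) <=
    enorm (x_ k - y) ^+ 2 + n%:R ^+ 2 * alpha k ^+ 2.
  move=> Oy k1; rewrite x_rec//.
  by apply: heron_step => //; exact/ltW/alpha_gt0.
have fejer y m k : Omega y -> D y = V -> (1 <= m)%N -> (m <= k)%N ->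
    enorm (x_ k - y) ^+ 2 <=
    enorm (x_ m - y) ^+ 2 + n%:R ^+ 2 * \sum_(m <= j < k) alpha j ^+ 2.
  move=> Oy Dy m1 mk; rewrite mulr_sumr.
  have := @telescope_le _ (fun k => enorm (x_ k - y) ^+ 2) (fun=> 0)
    (fun j => n%:R ^+ 2 * alpha j ^+ 2) _ _ _ mk.
  rewrite big1// addr0; apply => j mj; rewrite addr0.
  have j1 := leq_trans m1 mj; apply: le_trans (step y j Oy j1).
  rewrite lerDl mulr_ge0//; first by rewrite mulr_ge0// ltW// alpha_gt0.
  by rewrite subr_ge0 Dy; exact/xbar_min/xO.
have tail := summable_tail_lt (fun k _ => sqr_ge0 (alpha k)) alpha_sum2.
have near_opt e N : 0 < e -> exists2 k, (N <= k)%N & D (x_ k) - V < e.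
  move=> e0.
  exact: (@exists_small_gap _ (fun k => enorm (x_ k - xbar) ^+ 2) _ alpha
    (n%:R ^+ 2) e N (fun k => sqr_ge0 _) (sqr_ge0 _) alpha_gt0 alpha_sum
    alpha_sum2 (fun k => step xbar k Oxbar)).
have [N N1 tailN] := tail 1 ltr01.
(* The squares past [N] sum to less than 1, so [fejer] bounds the squared distance [r ^ 2];
   [r <= 1 + r ^ 2] then bounds the distance itself. *)
pose M := 1 + (enorm (x_ N - xbar) ^+ 2 + n%:R ^+ 2).
have xM k : (N <= k)%N -> enorm (x_ k - xbar) <= M.
  move=> Nk; have := fejer xbar N k Oxbar erefl N1 Nk.
  have /ltW /(ler_wpM2l (sqr_ge0 (n%:R : R))) := tailN N k (leqnn N).
  by rewrite /M; have := enorm_ge0 (x_ k - xbar); nra.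
pose K := Omega `&` (fun y => enorm (xbar - y)) @^-1` [set a | a <= M].
have cK : compact K.
  apply: bounded_closed_compact.
    apply/bounded_setP; exists (enorm xbar + M) => y [_ /= yM].
    apply: le_trans (ler_norm_enorm _) _; rewrite -[y](subKr xbar).
    by apply: le_trans (ler_enormD _ _) _; rewrite enormN lerD2l.
  apply: closedI => //; apply: preimage_closed; last exact: closed_le.
  by move=> y _; exact: continuous_enormB.
have inv_gt0 (j : nat) : 0 < (j.+1%:R : R)^-1 by rewrite invr_gt0 ltr0n.
(* Being at least [j], the indices [w j] occur arbitrarily late; being at least [N], they keep the
   iterates in [K]. *)
have [w wP] : {w : nat -> nat & forall j,
    (maxn j N <= w j)%N /\ D (x_ (w j)) - V < j.+1%:R^-1}.
  apply: (@choice _ _ (fun j k => (maxn j N <= k)%N /\ D (x_ k) - V < j.+1%:R^-1)).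
  by move=> j; have [k] := near_opt _ (maxn j N) (inv_gt0 j); exists k.
have Nw j : (N <= w j)%N by have [] := wP j; rewrite geq_max => /andP[].
have jw j : (j <= w j)%N by have [] := wP j; rewrite geq_max => /andP[].
have Kw j : K (x_ (w j)).
  split=> /=; first exact/xO/(leq_trans N1).
  by rewrite enormBC xM.
have [z [Oz _] clz] := compact_cluster_enorm cK Kw.
(* The cost is [n]-Lipschitz, so [D z] exceeds [D (x_ (w j))] by at most [(n + 1) * d = e / 2], and
   that value exceeds [V] by less than [e / 2]. *)
have Dz : D z = V.
  apply/eqP; rewrite eq_le [V <= _]xbar_min// andbT.
  apply/ler_addgt0Pr => e e0.
  pose d := e / (2 * (n%:R + 1)).
  have d0 : 0 < d by rewrite divr_gt0// mulr_gt0// ltr_wpDl.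
  have e2 : 0 < e / 2 by rewrite divr_gt0.
  have [J _ Je] := near_infty_natSinv_lt (PosNum e2).
  have [j Jj zj] := clz d J d0.
  have := heron_costB Omegas_neq0 z (x_ (w j)); rewrite -/D => Dzw.
  have [_ /lt_trans /(_ (Je j Jj)) /= Dw] := wP j.
  have : n%:R * enorm (z - x_ (w j)) <= (n%:R + 1) * d.
    by rewrite ler_pM ?enorm_ge0// ?lerDl// ltW.
  have -> : (n%:R + 1) * d = e / 2.
    by rewrite /d; field; rewrite gt_eqF// ltr_wpDl.
  by lra.
split.
  exists z; split; first by split=> // y Oy; rewrite -/D Dz; exact: xbar_min.
  apply/(@cvgrPdist_le _ _ _ _ _) => e e0.
  have e2 : 0 < e ^+ 2 / 2 by rewrite divr_gt0// exprn_gt0.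
  have n1_gt0 : 0 < (n%:R ^+ 2 + 1 : R) by rewrite ltr_wpDl// sqr_ge0.
  (* Of the target [e ^+ 2] in [fejer] at [z], half goes to the error sum and half to the squared
     starting distance. *)
  have [m m1 tailm] := tail _ (divr_gt0 e2 n1_gt0).
  (* A distance below both 1 and [e ^+ 2 / 2] has its square below [e ^+ 2 / 2]. *)
  have [|j mj zj] := clz (Num.min 1 (e ^+ 2 / 2)) m; first by rewrite lt_min ltr01.
  have mwj : (m <= w j)%N := leq_trans mj (jw j).
  exists (w j) => // k /= wjk; apply: le_trans (ler_norm_enorm _) _.
  rewrite enormBC -(@ler_pXn2r _ 2)// ?nnegrE ?enorm_ge0 ?(ltW e0)//.
  apply: le_trans (fejer z _ _ Oz Dz (leq_trans m1 mwj) wjk) _.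
  have := tailm (w j) k mwj; rewrite ltr_pdivlMr// => tl.
  have S0 : 0 <= \sum_(w j <= i < k) alpha i ^+ 2.
    by apply: sumr_ge0 => i _; exact: sqr_ge0.
  move: zj; rewrite enormBC lt_min => /andP[z1 z2].
  by have := enorm_ge0 (x_ (w j) - z); nra.
(* For [k >= j] the best value lies between [V] and [D (x_ j)], so one near-optimal iterate settles
   all later [k]. *)
rewrite valE; apply/cvgrPdist_le => e e0.
have [j j1 je] := near_opt e 1 e0.
exists j => // k /= jk.
have Vk : V <= heron_best Omegas x_ k.
  by apply: le_heron_best => i i1; exact/xbar_min/xO.
rewrite distrC ger0_norm ?subr_ge0//; apply: le_trans (ltW je).
by rewrite lerD2r heron_best_le// j1.
Qed.
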